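(* Let $s$ be a prime power and let $\ell\geq 2$ and $\tilde{\kappa}$ be positive integers with $\tilde{\kappa}\leq s\,\frac{s^{\ell-1}-1}{s-1}$. Then there exists an array $A\in\{1,\ldots,s\}^{s^{\ell}\times\left(\frac{s^{\ell}-1}{s-1}+\tilde{\kappa}\right)}$ (with $N=s^{\ell}$ runs, $k=\frac{s^{\ell}-1}{s-1}+\tilde{\kappa}$ factors and $s$ levels) such that: (0) $A$ is an orthogonal array of strength one; (1a) the first $\frac{s^{\ell}-1}{s-1}$ columns of $A$ form an orthogonal array of strength two; (1b) the last $\tilde{\kappa}$ columns of $A$ form an orthogonal array of strength two; (2) $\mathrm{Tol}_2(A)=s^{\ell-2}$; (3) for every $p\in[1,\infty)$, $\mathrm{Unb}_{p,2}(A)=\tilde{\kappa}\,s^2(s-1)\,s^{(\ell-2)p}$.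
   Context: For an $N\times k$ array $A$ with entries in a set $S$ of size $s$ and $t\leq k$, let $T_{t,k}=\{(j_1,\ldots,j_t)\in[k]^t: 1\leq j_1<\cdots<j_t\leq k\}$, and for $x\in S^t$, $j\in T_{t,k}$ let $n(A,x,j)=\#\{i\in[N]: A_{i,j_r}=x_r \text{ for all } r\in[t]\}$. $A$ is an orthogonal array of strength $t$ if $n(A,x,j)=N/s^t$ for all $x\in S^t$, $j\in T_{t,k}$ (a set of columns ''forms an orthogonal array of strength $t$'' if the subarray consisting of those columns does). The tolerance of strength $t$ is $\mathrm{Tol}_t(A)=\max\{|n(A,x,j)-N/s^t|: x\in S^t, j\in T_{t,k}\}$, and for $p\in[1,\infty)$ the $p$-unbalance of strength $t$ is $\mathrm{Unb}_{p,t}(A)=\sum_{x\in S^t}\sum_{j\in T_{t,k}}|n(A,x,j)-N/s^t|^p$. *)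

(* Defs.v *)
From HB Require Import structures.
From mathcomp Require Import all_boot all_order all_algebra.
From mathcomp Require Import reals exp.

Set Implicit Arguments.
Unset Strict Implicit.
Unset Printing Implicit Defensive.

Import Order.TTheory GRing.Theory Num.Theory.
Local Open Scope ring_scope.

Definition prime_power (s : nat) : Prop :=
  exists q e : nat, [/\ prime q, (0 < e)%N & s = (q ^ e)%N].

Definition col_tuples (t k : nat) : {set {ffun 'I_t -> 'I_k}} :=
  [set j : {ffun 'I_t -> 'I_k} |
    [forall a : 'I_t, forall b : 'I_t, (a < b)%N ==> (j a < j b)%N]].

Definition occ (S : finType) (N k t : nat) (A : 'M[S]_(N, k))
    (x : {ffun 'I_t -> S}) (j : {ffun 'I_t -> 'I_k}) : nat :=
  #|[set i : 'I_N | [forall r : 'I_t, A i (j r) == x r]]|.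

(* N / s^t need not be an integer, hence the equality in rat.  When k < t
   there are no column tuples and the condition holds vacuously. *)
Definition orthogonal_array (S : finType) (N k t : nat) (A : 'M[S]_(N, k)) : Prop :=
  forall (x : {ffun 'I_t -> S}) (j : {ffun 'I_t -> 'I_k}),
    j \in col_tuples t k ->
    (occ A x j)%:R = N%:R / #|S|%:R ^+ t :> rat.

Definition deviation (R : realType) (S : finType) (N k t : nat) (A : 'M[S]_(N, k))
    (x : {ffun 'I_t -> S}) (j : {ffun 'I_t -> 'I_k}) : R :=
  `| (occ A x j)%:R - N%:R / #|S|%:R ^+ t |.

(* Deviations are nonnegative, so starting the maximum at 0 only matters when
   there is nothing to maximise over. *)
Definition tolerance (R : realType) (S : finType) (N k : nat) (t : nat)
    (A : 'M[S]_(N, k)) : R :=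
  \big[Num.max/0]_(x : {ffun 'I_t -> S})
    \big[Num.max/0]_(j in col_tuples t k) deviation R A x j.

Definition unbalance (R : realType) (S : finType) (N k : nat) (p : R) (t : nat)
    (A : 'M[S]_(N, k)) : R :=
  \sum_(x : {ffun 'I_t -> S})
    \sum_(j in col_tuples t k) deviation R A x j `^ p.

Arguments orthogonal_array {S N k} t A.
Arguments tolerance R {S N k} t A.
Arguments unbalance {R S N k} p t A.

(* Main.v *)
Require Import Defs.
From HB Require Import structures.
From mathcomp Require Import all_boot all_order all_algebra.
From mathcomp Require Import finfield ring.
From mathcomp Require Import reals exp.

Set Implicit Arguments.
Unset Strict Implicit.
Unset Printing Implicit Defensive.

Import Order.TTheory GRing.Theory Num.Theory.
Local Open Scope ring_scope.

(** Let F be the field with s elements and index the runs by pairs (x, w) in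
    F * F^(l-1).  Choose one representative h of each line of F^(l-1).  The
    first columns are x and the forms h.w + c x with c in F: one form per line
    of the dual of F^l.  The last columns are among the functions
    h.w + c x + x^2.  Two columns with different h, or the column x and any
    other column, take each pair of values s^(l-2) times; two columns with the
    same h take a pair of values s^(l-2) r times, where r counts the solutions
    x of an equation between their x-parts.  Within each block this equation is
    affine and r = 1.  Across the blocks it is x^2 + g x = d, so r is 0, 1 or 2,
    and r = 1 for exactly s of the s^2 pairs (g, d), namely those for which
    x^2 + g x - d is a square. *)

(** * Solution counts of linear systems, and representatives of lines *)

Section Counting.

Variable F : finFieldType.

(** A right inverse [B] of [A] makes translation by [B *m (z - y)] a bijection from the fiber over
    [y] to the fiber over [z]. So all fibers have the same size, and they partition the space. The
    product form avoids the truncated exponent [m - t]. *)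
Lemma card_mulmx_fiber t m (A : 'M[F]_(t, m)) (y : 'cV_t) : row_free A ->
  (#|[set w : 'cV_m | A *m w == y]| * #|F| ^ t)%N = (#|F| ^ m)%N.
Proof.
case/row_freeP => B AB.
have fiberE (z : 'cV_t) :
    #|[set w : 'cV_m | A *m w == z]| = #|[set w : 'cV_m | A *m w == y]|.
  rewrite -[RHS](card_imset _ (addIr (B *m (z - y)))); apply: eq_card => w.
  rewrite inE; apply/eqP/imsetP => [Aw | [w' + ->]].
    exists (w - B *m (z - y)); last by rewrite subrK.
    by rewrite inE mulmxBr mulmxA AB mul1mx Aw opprB addrC subrK.
  by rewrite inE mulmxDr mulmxA AB mul1mx => /eqP ->; rewrite addrC subrK.
have -> : (#|F| ^ m)%N = #|{: 'cV[F]_m}| by rewrite card_mx muln1.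
rewrite -[RHS]sum1_card (partition_big (mulmx A) predT) //=.
rewrite (eq_bigr (fun=> #|[set w : 'cV_m | A *m w == y]|)).
  by rewrite sum_nat_const card_mx muln1 mulnC.
by move=> z _; rewrite sum1_card -(fiberE z) cardsE.
Qed.

Definition proportional m (u v : 'rV[F]_m) :=
  [exists a : F, (a != 0) && (u == a *: v)].

Lemma proportionalP m (u v : 'rV[F]_m) :
  reflect (exists2 a, a != 0 & u = a *: v) (proportional u v).
Proof.
apply: (iffP existsP) => [[a /andP[a0 /eqP->]]|[a a0 ->]]; exists a => //.
by rewrite a0 eqxx.
Qed.

Lemma proportional_equiv m : equivalence_rel (@proportional m).
Proof.
have sub (a : F) (u v : 'rV_m) :
    a != 0 -> proportional (a *: u) v = proportional u v.
  move=> a0; apply/proportionalP/proportionalP => -[b b0].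
    move=> /(congr1 (fun w => a^-1 *: w)); rewrite !scalerA mulVf // scale1r => ->.
    by exists (a^-1 * b); rewrite ?mulf_neq0 ?invr_eq0.
  by move=> ->; exists (a * b); rewrite ?mulf_neq0 ?scalerA.
move=> u v w; split; first by apply/proportionalP; exists 1; rewrite ?oner_neq0 ?scale1r.
by case/proportionalP => a a0 ->; apply: sub.
Qed.

(** [P] is a transversal of the partition of the nonzero vectors into lines without the origin; each
    class has [#|F| - 1] elements. *)
Lemma projective_representatives m :
  exists P : {set 'rV[F]_m},
    [/\ {in P, forall h, h != 0},
        {in P &, forall h h', h != h' -> row_free (col_mx h h')} &
        (#|P| * (#|F| - 1) = #|F| ^ m - 1)%N].
Proof.
pose D : {set 'rV[F]_m} := [set~ 0].
have eqvD : {in D & &, equivalence_rel (@proportional m)}.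
  by move=> u v w _ _ _; apply: proportional_equiv.
have partD := equivalence_partitionP eqvD.
have trD := transversalP partD.
set Q := equivalence_partition _ D in partD trD.
exists (transversal Q D).
have PD h : h \in transversal Q D -> h != 0.
  by move=> hP; have := subsetP (transversal_sub trD) _ hP; rewrite !inE.
split=> //.
- move=> h h' hP h'P neq; apply: inj_row_free => v.
  rewrite -[v]hsubmxK mul_row_col [lsubmx v]mx11_scalar [rsubmx v]mx11_scalar.
  rewrite !mul_scalar_mx; set a := lsubmx v 0 0; set b := rsubmx v 0 0 => ab0.
  (* A relation with [a != 0] would make [h] a multiple of [h'], hence put both in one class, where
     a transversal has a single element. *)
  have a0 : a = 0.
    apply/eqP; apply: contraNT neq => a0; apply/eqP.
    apply: (pblock_inj trD) => //; apply/esym/eqP.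
    have hE : h = (- b / a) *: h'.
      apply: (scalerI a0); rewrite scalerA mulrCA mulfV // mulr1 scaleNr.
      by apply/eqP; rewrite -addr_eq0 ab0.
    rewrite eq_sym eq_pblock ?(partition_trivIset partD) //; last first.
      by rewrite (cover_partition partD) !inE PD.
    rewrite pblock_equivalence_partition ?inE ?PD //.
    apply/proportionalP; exists (- b / a) => //.
    by apply: contra (PD _ hP) => /eqP c0; rewrite hE c0 scale0r.
  move: ab0; rewrite a0 scale0r add0r => /eqP.
  by rewrite scaler_eq0 (negPf (PD _ h'P)) orbF => /eqP ->; rewrite !raddf0 row_mx0.
- rewrite (card_transversal trD) -(card_uniform_partition _ partD).
    by rewrite cardsC1 card_mx mul1n subn1.
  move=> B /imsetP[u]; rewrite !inE => u0 ->.
  (* The class of [u] is the image of the nonzero scalars under [a *: u], which is injective in [a]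
     because [u] is nonzero. *)
  have -> : [set y in D | proportional u y] = (fun a => a *: u) @: [set~ 0].
    apply/setP => v; rewrite !inE; apply/andP/imsetP.
      case=> v0 /proportionalP[a a0 uE]; exists a^-1.
        by rewrite !inE invr_eq0.
      by rewrite uE scalerA mulVf // scale1r.
    case=> a; rewrite !inE => a0 ->; split; first by rewrite scaler_eq0 negb_or a0.
    by apply/proportionalP; exists a^-1; rewrite ?invr_eq0 // scalerA mulVf // scale1r.
  rewrite card_imset ?cardsC1 ?subn1 // => a b /eqP.
  by rewrite -subr_eq0 -scalerBl scaler_eq0 (negPf u0) orbF subr_eq0 => /eqP.
Qed.

Lemma card_set_pairE (T U : finType) (Q : T -> U -> bool) :
  #|[set v : T * U | Q v.1 v.2]| = (\sum_(x : T) #|[set w | Q x w]|)%N.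
Proof.
rewrite -sum1dep_card.
rewrite -(pair_big_dep predT Q (fun _ _ => 1%N)) /=.
by apply: eq_bigr => x _; rewrite sum1dep_card.
Qed.

End Counting.

(** * Joint frequencies of two columns on the run set *)

Section Columns.

Variables (F : finFieldType) (m : nat).

Local Notation V := (F * 'cV[F]_m.+1)%type.

(** The parameter [m] stands for [l - 2], so that [V] has [#|F| ^ l] elements. Keeping [q] arbitrary
    covers the linear and the quadratic columns at once. *)
Definition shifted_form (h : 'rV[F]_m.+1) (q : F -> F) (v : V) : F :=
  (h *m v.2) 0 0 + q v.1.

Definition joint_count (f g : V -> F) (a b : F) : nat :=
  #|[set v : V | (f v == a) && (g v == b)]|.

Lemma joint_countC f g a b : joint_count f g a b = joint_count g f b a.
Proof. by apply: eq_card => v; rewrite !inE andbC. Qed.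

Lemma card_form_fiber (h : 'rV[F]_m.+1) a : h != 0 ->
  #|[set w : 'cV_m.+1 | (h *m w) 0 0 == a]| = (#|F| ^ m)%N.
Proof.
move=> h0; have F0 : (0 < #|F|)%N by apply/card_gt0P; exists 0.
have hfree : row_free h by rewrite -row_leq_rank lt0n mxrank_eq0.
apply/eqP; rewrite -(eqn_pmul2r F0) -expnSr.
rewrite -(card_mulmx_fiber a%:M hfree) expn1; apply/eqP; congr (_ * _)%N.
apply: eq_card => w; rewrite !inE [h *m w]mx11_scalar !mxE mulr1n.
by apply/eqP/eqP => [->|/matrixP/(_ 0 0)]; rewrite ?mxE ?mulr1n.
Qed.

Lemma joint_count_fst h q a b : h != 0 ->
  joint_count fst (shifted_form h q) a b = (#|F| ^ m)%N.
Proof.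
move=> h0.
rewrite /joint_count
  (card_set_pairE (fun x w => (x == a) && ((h *m w) 0 0 + q x == b))).
rewrite (bigD1 a) //= big1 ?addn0 => [|x /negPf xa].
  rewrite -(card_form_fiber (b - q a) h0); apply: eq_card => w.
  by rewrite !inE eqxx /= (can2_eq (addrK _) (subrK _)).
by apply: eq_card0 => w; rewrite !inE xa.
Qed.

(** For each fixed [x] the values of [q] and [q'] only shift the right-hand side of an independent
    system in [w]. Multiplying by [#|F| ^ 2] avoids the exponent [m - 1] for a single [x]. *)
Lemma joint_count_indep h h' q q' a b : row_free (col_mx h h') ->
  joint_count (shifted_form h q) (shifted_form h' q') a b = (#|F| ^ m)%N.
Proof.
move=> hfree; have F0 : (0 < #|F|)%N by apply/card_gt0P; exists 0.
rewrite /joint_count (card_set_pairE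
  (fun x w => ((h *m w) 0 0 + q x == a) && ((h' *m w) 0 0 + q' x == b))).
have F20 : (0 < #|F| ^ 2)%N by rewrite expn_gt0 F0.
apply/eqP; rewrite -(eqn_pmul2r F20) big_distrl /=.
rewrite (eq_bigr (fun=> #|F| ^ m.+1)%N) => [|x _].
  by rewrite sum_nat_const -expnD -expnS addn2.
rewrite -(card_mulmx_fiber (col_mx (a - q x)%:M (b - q' x)%:M) hfree).
congr (_ * _)%N; apply: eq_card => w; rewrite !inE mul_col_mx.
rewrite [h *m w]mx11_scalar [h' *m w]mx11_scalar !mxE !mulr1n.
rewrite !(can2_eq (addrK _) (subrK _)).
apply/andP/eqP => [[/eqP -> /eqP ->] // | /eq_col_mx[]].
by move=> /matrixP/(_ 0 0) + /matrixP/(_ 0 0); rewrite !mxE !mulr1n => -> ->.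
Qed.

(** For fixed [x] both equations prescribe the value of the same form [h] at [w]. They are
    compatible exactly when [q' x - q x = b - a], and then [#|F| ^ m] vectors [w] remain. *)
Lemma joint_count_same h q q' a b : h != 0 ->
  joint_count (shifted_form h q) (shifted_form h q') a b =
  (#|F| ^ m * #|[set x | (q' x - q x == b - a)%R]|)%N.
Proof.
move=> h0; rewrite /joint_count (card_set_pairE
  (fun x w => ((h *m w) 0 0 + q x == a) && ((h *m w) 0 0 + q' x == b))).
rewrite mulnC -sum1_card big_distrl /= [RHS]big_mkcond /=.
apply: eq_bigr => x _; rewrite inE mul1n.
have [qE|qN] := eqVneq.
  rewrite -(card_form_fiber (a - q x) h0); apply: eq_card => w.
  rewrite !inE !(can2_eq (addrK _) (subrK _)).
  have -> : b - q' x = a - q x by rewrite -[q' x](subrK (q x)) qE; ring.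
  exact: andbb.
apply: eq_card0 => w; rewrite !inE; apply: contra_neqF qN => /andP[/eqP<- /eqP<-].
by rewrite opprD addrACA subrr add0r.
Qed.

Lemma card_shifted_form_fiber h q a : h != 0 ->
  #|[set v | shifted_form h q v == a]| = (#|F| ^ m.+1)%N.
Proof.
move=> h0; rewrite (card_set_pairE (fun x w => (h *m w) 0 0 + q x == a)).
rewrite (eq_bigr (fun=> #|F| ^ m)%N) => [|x _].
  by rewrite sum_nat_const expnS.
rewrite -(card_form_fiber (a - q x) h0); apply: eq_card => w.
by rewrite !inE (can2_eq (addrK _) (subrK _)).
Qed.

Lemma card_fst_fiber a : #|[set v : V | v.1 == a]| = (#|F| ^ m.+1)%N.
Proof.
rewrite (card_set_pairE (fun x (w : 'cV_m.+1) => x == a)) (bigD1 a) //= big1 ?addn0.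
  have := card_mx F m.+1 1; rewrite muln1 => <-.
  by apply: eq_card => w; rewrite !inE eqxx.
by move=> x /negPf xa; apply: eq_card0 => w; rewrite inE xa.
Qed.

End Columns.

(** * Monic quadratic equations in any characteristic *)

Section Quadratic.

Variable F : finFieldType.

Definition quad_roots (g d : F) := [set x : F | x ^+ 2 + g * x == d].

(** The two roots sum to [- g]. Factoring through a known root needs no discriminant, so
    characteristic 2 is included; the two roots may coincide. *)
Lemma quad_rootsP g d r : r \in quad_roots g d ->
  quad_roots g d = [set r; - g - r].
Proof.
rewrite inE => /eqP rE; apply/setP => x; rewrite !inE -rE -subr_eq0.
have -> : x ^+ 2 + g * x - (r ^+ 2 + g * r) = (x - r) * (x - (- g - r)) by ring.
by rewrite mulf_eq0 !subr_eq0.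
Qed.

Lemma card_quad_roots_le2 g d : (#|quad_roots g d| <= 2)%N.
Proof.
have [->|[r /quad_rootsP ->]] := set_0Vmem (quad_roots g d); first by rewrite cards0.
by rewrite cards2; case: (_ != _).
Qed.

(* Exactly one root means [x ^+ 2 + g * x - d = (x - r) ^+ 2], so such pairs
   [(g, d)] are parametrised by [r]. *)
Lemma card_quad_single_root :
  #|[set gd : F * F | #|quad_roots gd.1 gd.2| == 1%N]| = #|F|.
Proof.
(* The coefficients come from expanding [(x - r) ^+ 2 = 0]. *)
pose dbl (r : F) := (- (r + r), - r ^+ 2).
have dbl_roots r : quad_roots (dbl r).1 (dbl r).2 = [set r].
  rewrite (@quad_rootsP _ _ r) /=; last by rewrite inE; apply/eqP; ring.
  by rewrite opprK addrK setUid.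
rewrite -[RHS](card_imset (f := dbl) (mem F)); last first.
  (* Injectivity is read off the root set, since in characteristic 2 the first component of [dbl r]
     is always 0. *)
  by move=> r r' e; apply: set1_inj; rewrite -!dbl_roots e.
apply: eq_card => -[g d]; rewrite inE /=.
apply/idP/imsetP => [/cards1P[r rE] | [r _ [-> ->]]].
  have rroot : r \in quad_roots g d by rewrite rE set11.
  have : - g - r \in quad_roots g d by rewrite (quad_rootsP rroot) set22.
  rewrite rE inE => /eqP gr; exists r => //.
  have gE : g = - (r + r) by rewrite -{1}gr; ring.
  move: rroot; rewrite inE => /eqP <-; rewrite /dbl gE; congr pair; ring.
by rewrite (dbl_roots r) cards1.
Qed.

End Quadratic.

(** * The linear and the quadratic columns, and their imbalance *)

Section ColumnFamilies.

Variables (F : finFieldType) (m : nat).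

Local Notation V := (F * 'cV[F]_m.+1)%type.

(** [None] encodes the one line of forms with no [w]-part, that of the coordinate [x]. *)
Definition linear_column (u : option ('rV[F]_m.+1 * F)) : V -> F :=
  if u is Some (h, c) then shifted_form h (fun x => c * x) else fst.

Definition quadratic_column (u : 'rV[F]_m.+1 * F) : V -> F :=
  shifted_form u.1 (fun x => u.2 * x + x ^+ 2).

Variable P : {set 'rV[F]_m.+1}.
Hypothesis P_neq0 : {in P, forall h, h != 0}.
Hypothesis P_free : {in P &, forall h h', h != h' -> row_free (col_mx h h')}.

Definition quadratic_indices : {set 'rV[F]_m.+1 * F} := setX P setT.

Definition linear_indices : {set option ('rV[F]_m.+1 * F)} :=
  None |: Some @: quadratic_indices.

Lemma card_quadratic_indices : #|quadratic_indices| = (#|F| * #|P|)%N.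
Proof. by rewrite cardsX cardsT mulnC. Qed.

Lemma card_linear_indices : #|linear_indices| = (#|F| * #|P|).+1.
Proof.
rewrite cardsU1 card_imset; last by move=> ? ? [].
by rewrite card_quadratic_indices; case: imsetP => // -[].
Qed.

Lemma quadratic_indicesE u : (u \in quadratic_indices) = (u.1 \in P).
Proof. by rewrite !inE andbT. Qed.

Lemma Some_linear_indices u : (Some u \in linear_indices) = (u.1 \in P).
Proof.
rewrite !inE /= -quadratic_indicesE.
by apply: mem_imset => ? ? [].
Qed.

Lemma card_linear_root (c d : F) : c != 0 -> #|[set x | c * x == d]| = 1%N.
Proof.
move=> c0; apply/eqP/cards1P; exists (c^-1 * d); apply/setP => x.
by rewrite !inE; apply/eqP/eqP => [<-|->]; rewrite ?mulKf ?mulVKf.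
Qed.

Lemma linear_column_fiber u a : u \in linear_indices ->
  #|[set v | linear_column u v == a]| = (#|F| ^ m.+1)%N.
Proof.
case: u => [[h c]|] uL; last exact: card_fst_fiber.
by apply: card_shifted_form_fiber; apply: P_neq0; rewrite Some_linear_indices in uL.
Qed.

Lemma quadratic_column_fiber u a : u \in quadratic_indices ->
  #|[set v | quadratic_column u v == a]| = (#|F| ^ m.+1)%N.
Proof.
by rewrite quadratic_indicesE => hP; apply/card_shifted_form_fiber/P_neq0.
Qed.

(** If [h = h'] then [c != c'], and the [x]-parts differ by a nonzero multiple of [x], which takes
    each value once. *)
Lemma linear_columns_count u u' a b :
    u \in linear_indices -> u' \in linear_indices -> u != u' ->
  joint_count (linear_column u) (linear_column u') a b = (#|F| ^ m)%N.
Proof.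
case: u u' => [[h c]|] [[h' c']|] //=; rewrite ?Some_linear_indices /=.
- move=> hP h'P neq; have [eh|nh] := eqVneq h h'; last exact/joint_count_indep/P_free.
  subst h'; rewrite joint_count_same ?P_neq0 //.
  under eq_finset do rewrite -mulrBl.
  rewrite card_linear_root ?muln1 // subr_eq0; apply: contra neq => /eqP ->.
  exact: eqxx.
- by move=> hP _ _; rewrite joint_countC joint_count_fst ?P_neq0.
- by move=> _ hP _; rewrite joint_count_fst ?P_neq0.
Qed.

(* The common square [x ^+ 2] cancels, so two columns with the same [h] differ
   by a nonconstant affine function of [x]. *)
Lemma quadratic_columns_count u u' a b :
    u \in quadratic_indices -> u' \in quadratic_indices -> u != u' ->
  joint_count (quadratic_column u) (quadratic_column u') a b = (#|F| ^ m)%N.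
Proof.
case: u u' => [h c] [h' c']; rewrite !quadratic_indicesE /= => hP h'P neq.
have [eh|nh] := eqVneq h h'; last exact/joint_count_indep/P_free.
subst h'; rewrite joint_count_same ?P_neq0 //=.
under eq_finset do rewrite opprD addrACA subrr addr0 -mulrBl.
rewrite card_linear_root ?muln1 // subr_eq0; apply: contra neq => /eqP ->.
exact: eqxx.
Qed.

Lemma mixed_columns_count u h c a b :
    u \in linear_indices -> h \in P ->
  joint_count (linear_column u) (quadratic_column (h, c)) a b =
  (#|F| ^ m *
    (if u is Some (h', c') then
       if h' == h then #|quad_roots (c - c')%R (b - a)%R| else 1 else 1))%N.
Proof.
case: u => [[h' c']|] /=; last by move=> _ hP; rewrite joint_count_fst ?P_neq0 ?muln1.
rewrite Some_linear_indices /= => h'P hP; have [->|nh] := eqVneq h' h; last first.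
  by rewrite muln1; apply/joint_count_indep/P_free.
rewrite joint_count_same ?P_neq0 //=; congr (_ * _)%N; apply: eq_card => x.
by rewrite !inE mulrBl addrAC addrC.
Qed.

Lemma sum_linear_indices (U : nmodType) (X : option ('rV[F]_m.+1 * F) -> U) :
  \sum_(u in linear_indices) X u =
  X None + \sum_(h in P) \sum_(c : F) X (Some (h, c)).
Proof.
rewrite big_setU1 /=; last by apply/imsetP => -[].
rewrite big_imset /=; last by move=> ? ? _ _ [].
rewrite pair_big_dep /=; congr (_ + _).
by apply: eq_big => [u|[h c] _] //; rewrite quadratic_indicesE andbT.
Qed.

(** Only the linear columns sharing the form [h] of [r] contribute. For each [a], the pair of
    [c - c'] and [b - a] runs once through all [(g, d)], of which [#|F| ^ 2 - #|F|] do not have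
    exactly one root. A general [G] lets one count serve every exponent [p]. *)
Lemma sum_mixed_columns (U : nmodType) (G : nat -> U) (D : U) r :
    G (#|F| ^ m)%N = 0 -> G 0%N = D -> G (#|F| ^ m * 2)%N = D ->
    r \in quadratic_indices ->
  \sum_(u in linear_indices) \sum_(a : F) \sum_(b : F)
    G (joint_count (linear_column u) (quadratic_column r) a b) =
  D *+ (#|F| ^ 2 * (#|F| - 1)).
Proof.
move=> G1 G0 G2; case: r => h c; rewrite quadratic_indicesE /= => hP.
have GE g d : G (#|F| ^ m * #|quad_roots g d|)%N =
    if #|quad_roots g d| == 1%N then 0 else D.
  have := card_quad_roots_le2 g d.
  by case: #|_| => [|[|[|n]]] //=; rewrite ?muln0 ?muln1.
under eq_bigr => u uL do under eq_bigr => a _ do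
  under eq_bigr => b _ do rewrite mixed_columns_count //.
rewrite sum_linear_indices big1 ?add0r; last first.
  by move=> a _; rewrite big1 // => b _; rewrite muln1.
rewrite (bigD1 h) //= [X in _ + X]big1 ?addr0; last first.
  move=> h' /andP[_ /negPf hh']; do 3![rewrite big1 // => ? _].
  by rewrite hh' muln1.
rewrite eqxx exchange_big /=.
rewrite (eq_bigr (fun=> D *+ (#|F| * #|F| - #|F|))) => [|a _].
  by rewrite sumr_const -mulrnA mulnBl mulnBr muln1 mulnn.
(* The substitutions [c' = c - g] and [b = d + a] turn the equation into [x ^+ 2 + g * x = d]. *)
rewrite (reindex_inj (subrI c)) /=.
under eq_bigr => g _ do rewrite (reindex_inj (addIr a)) /=.
under eq_bigr => g _ do under eq_bigr => d _ do rewrite addrK subKr GE -if_neg.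
rewrite pair_big /= -big_mkcond sumr_const /=; congr (_ *+ _).
have := cardsC [set gd : F * F | #|quad_roots gd.1 gd.2| == 1%N].
rewrite card_quad_single_root card_prod => <-; rewrite addKn.
by apply: eq_card => gd; rewrite !inE.
Qed.

End ColumnFamilies.

(** * Tuples of length two as pairs *)

Lemma forall_ord2 (Q : pred 'I_2) : [forall r, Q r] = Q ord0 && Q ord_max.
Proof.
apply/forallP/andP => [Qr | [Q0 Q1] r] //.
have [->|nr] := eqVneq r ord0; first by [].
suff -> : r = ord_max by [].
by apply/val_inj; move: nr; case: r => -[|[|]].
Qed.

Lemma col_tuples2 k (j : {ffun 'I_2 -> 'I_k}) :
  (j \in col_tuples 2 k) = (j ord0 < j ord_max)%N.
Proof. by rewrite inE !forall_ord2 /= andbT. Qed.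

(** With [Q] the strict order this handles the column tuples, with [Q] always true the value
    tuples. *)
Lemma sum_ffun2 (U : nmodType) (T : finType) (Q : rel T) (G : T -> T -> U) :
  \sum_(x : {ffun 'I_2 -> T} | Q (x ord0) (x ord_max)) G (x ord0) (x ord_max) =
  \sum_(a : T) \sum_(b : T | Q a b) G a b.
Proof.
rewrite pair_big_dep /=.
pose mk (p : T * T) : {ffun 'I_2 -> T} := [ffun r => if r == ord0 then p.1 else p.2].
rewrite (reindex mk); first by apply: eq_big => [p|p _]; rewrite !ffunE.
exists (fun x : {ffun 'I_2 -> T} => (x ord0, x ord_max)) => [[a b] _|x _].
  by rewrite !ffunE.
apply/ffunP => r; rewrite ffunE; case: eqP => [-> //|/eqP nr] /=.
by congr (x _); apply/val_inj; move: nr; case: r => -[|[|]].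
Qed.

(** * From functions on the run set to arrays *)

Section Arrays.

Variables (T V : finType) (s N : nat).
Variables (rows : 'I_N -> V) (label : T -> 'I_s) (unlabel : 'I_s -> T).
Hypotheses (rows_bij : bijective rows) (labelK : cancel label unlabel)
  (unlabelK : cancel unlabel label).

(** The bijections [rows] and [label] only number the runs and the levels, so all counting can stay
    in [V] and [T]. *)
Definition array_of k (c : 'I_k -> V -> T) : 'M['I_s]_(N, k) :=
  \matrix_(i, j) label (c j (rows i)).

Lemma occ_array_of k t (c : 'I_k -> V -> T) (x : {ffun 'I_t -> 'I_s}) j :
  occ (array_of c) x j = #|[set v | [forall r, c (j r) v == unlabel (x r)]]|.
Proof.
rewrite /occ -(card_imset _ (bij_inj rows_bij)); apply: eq_card => v.
have [rows' rowsK rowsK'] := rows_bij.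
rewrite -[v]rowsK' (mem_imset _ _ (bij_inj rows_bij)) !inE.
by apply: eq_forallb => r; rewrite mxE (can2_eq labelK unlabelK).
Qed.

Lemma occ2_array_of k (c : 'I_k -> V -> T) (x : {ffun 'I_2 -> 'I_s}) j :
  occ (array_of c) x j =
  #|[set v | (c (j ord0) v == unlabel (x ord0)) &&
             (c (j ord_max) v == unlabel (x ord_max))]|.
Proof. by rewrite occ_array_of; apply: eq_card => v; rewrite !inE forall_ord2. Qed.

Hypothesis s_gt0 : (0 < s)%N.

Lemma orthogonal_array1_of k (c : 'I_k -> V -> T) n : N = (n * s)%N ->
    (forall j a, #|[set v | c j v == a]| = n) ->
  orthogonal_array 1 (array_of c).
Proof.
move=> NE cE x j _; rewrite occ_array_of.
have -> : [set v | [forall r, c (j r) v == unlabel (x r)]] =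
          [set v | c (j ord0) v == unlabel (x ord0)].
  apply/setP => v; rewrite !inE; apply/forallP/idP => [//|cv r].
  by rewrite (ord1 r).
by rewrite cE NE card_ord expr1 natrM mulfK // pnatr_eq0 -lt0n.
Qed.

Variable n : nat.
Hypothesis N_eq : N = (n * s ^ 2)%N.

Lemma strength2_frequency (R : numFieldType) : N%:R / #|'I_s|%:R ^+ 2 = n%:R :> R.
Proof.
by rewrite N_eq card_ord natrM natrX mulfK // expf_neq0 // pnatr_eq0 -lt0n.
Qed.

Lemma orthogonal_array2_of k (c : 'I_k -> V -> T) :
    (forall j j' a b, j != j' ->
       #|[set v | (c j v == a) && (c j' v == b)]| = n) ->
  orthogonal_array 2 (array_of c).
Proof.
move=> cE x j; rewrite col_tuples2 => jj'.
rewrite strength2_frequency occ2_array_of cE //.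
by apply: contraTneq jj' => ->; rewrite ltnn.
Qed.

Lemma deviation2_array_of (R : realType) k (c : 'I_k -> V -> T)
    (x : {ffun 'I_2 -> 'I_s}) (j : {ffun 'I_2 -> 'I_k}) :
  deviation R (array_of c) x j =
  `| #|[set v | (c (j ord0) v == unlabel (x ord0)) &&
               (c (j ord_max) v == unlabel (x ord_max))]|%:R - n%:R |.
Proof. by rewrite /deviation strength2_frequency occ2_array_of. Qed.

Lemma unbalance2_array_of (R : realType) k (c : 'I_k -> V -> T) (p : R) :
  unbalance p 2 (array_of c) =
  \sum_(i < k) \sum_(i' < k | (i < i')%N) \sum_(a : T) \sum_(b : T)
    `| #|[set v | (c i v == a) && (c i' v == b)]|%:R - n%:R | `^ p.
Proof.
rewrite /unbalance exchange_big /=.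
under eq_bigl do rewrite col_tuples2.
have ub : bijective unlabel by exists label.
pose H i i' := \sum_(a : T) \sum_(b : T)
    `| #|[set v | (c i v == a) && (c i' v == b)]|%:R - n%:R | `^ p.
rewrite -(sum_ffun2 (fun i i' : 'I_k => (i < i')%N) H).
apply: eq_bigr => j _.
pose K (y z : 'I_s) := `| #|[set v | (c (j ord0) v == unlabel y) &&
               (c (j ord_max) v == unlabel z)]|%:R - n%:R : R | `^ p.
have -> : H (j ord0) (j ord_max) = \sum_y \sum_z K y z.
  rewrite /H (reindex unlabel); last exact: onW_bij.
  by apply: eq_bigr => y _; rewrite (reindex unlabel) //; apply: onW_bij.
rewrite -(sum_ffun2 (fun _ _ => true) K) /=.
by apply: eq_bigr => x _; rewrite deviation2_array_of.
Qed.

End Arrays.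

(** If the maximum were below [v], every deviation would be 0 and the unbalance would vanish. A
    nonzero unbalance thus replaces an explicit tuple attaining [v]. *)
Lemma tolerance_eq (R : realType) (S : finType) (N k t : nat)
    (A : 'M[S]_(N, k)) (v : R) : 0 < v ->
    (forall x j, j \in col_tuples t k ->
       deviation R A x j = 0 \/ deviation R A x j = v) ->
    unbalance (1 : R) t A != 0 -> tolerance R t A = v.
Proof.
move=> v0 devE unb; apply/eqP; rewrite eq_le; apply/andP; split.
  apply: bigmax_le; first exact: ltW.
  move=> x _; apply: bigmax_le; first exact: ltW.
  by move=> j /(devE x)[] ->; rewrite // ltW.
rewrite leNgt; apply: contra unb => tol; apply/eqP.
rewrite /unbalance big1 // => x _; rewrite big1 // => j jT.
have [->|dv] := devE x j jT; first by rewrite powR0 ?oner_neq0.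
move: tol; rewrite ltNge -dv /tolerance (bigmax_sup x) //.
by rewrite (bigmax_sup j).
Qed.

(** Every left index precedes every right index, so a mixed increasing pair always has its left
    index first. *)
Lemma sum_increasing_pairs (U : nmodType) (k1 k2 : nat)
    (H : 'I_(k1 + k2) -> 'I_(k1 + k2) -> U) :
    (forall i i' : 'I_k1, (i < i')%N -> H (lshift k2 i) (lshift k2 i') = 0) ->
    (forall i i' : 'I_k2, (i < i')%N -> H (rshift k1 i) (rshift k1 i') = 0) ->
  \sum_(a < k1 + k2) \sum_(b < k1 + k2 | (a < b)%N) H a b =
  \sum_(j < k2) \sum_(i < k1) H (lshift k2 i) (rshift k1 j).
Proof.
move=> Hl Hr; under eq_bigr do rewrite big_mkcond /=.
rewrite big_split_ord /= [X in _ + X]big1 ?addr0 => [|i _]; last first.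
  rewrite big_split_ord /= !big1 ?addr0 // => j _.
    by case: ifP => //; rewrite ltn_add2l; apply: Hr.
  by rewrite ltnNge (leq_trans (ltnW (ltn_ord j)) (leq_addr i k1)).
rewrite [RHS]exchange_big /=.
apply: eq_bigr => i _; rewrite big_split_ord /= big1 ?add0r => [|j _].
  by apply: eq_bigr => j _; rewrite (leq_trans (ltn_ord i) (leq_addr j k1)).
by case: ifP => //; apply: Hl.
Qed.

Lemma enum_set_ord (T : finType) (D : {set T}) n : #|D| = n ->
  exists c : 'I_n -> T, [/\ injective c, forall i, c i \in D &
    forall (U : nmodType) (X : T -> U), \sum_(i < n) X (c i) = \sum_(x in D) X x].
Proof.
move=> <-; exists enum_val; split=> [|i|U X]; first exact: enum_val_inj.
  exact: enum_valP.
by rewrite [RHS]big_enum_val.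
Qed.

(** * Construction of the array and verification of its properties *)

Theorem theorem7p1 (R : realType) (s l kappa : nat)
    (hs : prime_power s) (hl : (2 <= l)%N) (hkappa0 : (0 < kappa)%N)
    (hkappa : (kappa <= s * ((s ^ (l - 1) - 1) %/ (s - 1)))%N) :
  exists A : 'M['I_s]_((s ^ l)%N, ((s ^ l - 1) %/ (s - 1) + kappa)%N),
    [/\ orthogonal_array 1 A,
        orthogonal_array 2 (lsubmx A),
        orthogonal_array 2 (rsubmx A),
        tolerance R 2 A = s%:R ^+ (l - 2) &
        forall p : R, 1 <= p ->
          unbalance p 2 A =
            kappa%:R * s%:R ^+ 2 * (s%:R - 1) * s%:R `^ ((l - 2)%:R * p)].
Proof.
have [F cardF] : exists F : finFieldType, #|F| = s.
  case: hs => q [e [pr_q e0 ->]].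
  by have [F _ cardF] := pPrimePowerField pr_q e0; exists F.
have s_gt1 : (1 < s)%N by rewrite -cardF finNzRing_gt1.
have s_gt0 : (0 < s)%N by apply: ltnW.
case: l hl hkappa => [|[|m]] // _; rewrite !subSS !subn0 => hkappa.
have [P [P_neq0 P_free cardP]] := projective_representatives F m.+1.
rewrite cardF in cardP.
have s1_gt0 : (0 < s - 1)%N by rewrite subn_gt0.
have cardPE : #|P| = ((s ^ m.+1 - 1) %/ (s - 1))%N by rewrite -cardP mulnK.
have cardL : #|linear_indices P| = ((s ^ m.+2 - 1) %/ (s - 1))%N.
  (* This is [s * (s ^ m.+1 - 1) + (s - 1)], with [#|P| * (s - 1)] inserted for [s ^ m.+1 - 1]. *)
  have -> : (s ^ m.+2 - 1 = (s * #|P|).+1 * (s - 1))%N.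
    rewrite mulSn -mulnA cardP mulnBr muln1 -expnS addnC addnBA //.
    by rewrite subnK // -[leqLHS]expn1 leq_exp2l.
  by rewrite mulnK // card_linear_indices cardF.
have [lc [lc_inj lcL lc_sum]] := enum_set_ord cardL.
have [rc0 [rc0_inj rc0Q _]] := enum_set_ord (erefl #|quadratic_indices P|).
have le_kappa : (kappa <= #|quadratic_indices P|)%N.
  by rewrite card_quadratic_indices cardF cardPE.
(* Any [kappa] distinct quadratic columns would do; the bound on [kappa] is exactly the number
   [s * #|P|] available. *)
pose rc j := rc0 (widen_ord le_kappa j).
have rc_inj : injective rc.
  by move=> i j /rc0_inj/(congr1 val) /= /val_inj.
have rcQ j : rc j \in quadratic_indices P by apply: rc0Q.
pose V := (F * 'cV[F]_m.+1)%type.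
have cardV : #|[set: V]| = (s ^ m.+2)%N.
  by rewrite cardsT card_prod card_mx muln1 cardF.
have [rows [rows_inj _ _]] := enum_set_ord cardV.
have rows_bij : bijective rows.
  by apply: inj_card_bij => //; rewrite card_ord -cardV cardsT.
have cardFT : #|[set: F]| = s by rewrite cardsT.
have [unlabel [unlabel_inj _ _]] := enum_set_ord cardFT.
have [label unlabelK labelK] : bijective unlabel.
  by apply: inj_card_bij => //; rewrite card_ord cardF.
set k1 := (_ %/ _)%N in cardL lc lc_inj lcL lc_sum *.
pose c (j : 'I_(k1 + kappa)) : V -> F :=
  match split j with
  | inl i => linear_column (lc i)
  | inr i => quadratic_column (rc i)
  end.
have cl i : c (lshift kappa i) = linear_column (lc i).
  by rewrite /c (unsplitK (inl i)).
have cr i : c (rshift k1 i) = quadratic_column (rc i).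
  by rewrite /c (unsplitK (inr i)).
pose A := array_of rows label c.
have Al : lsubmx A = array_of rows label (fun i => linear_column (lc i)).
  by apply/matrixP => i j; rewrite !mxE cl.
have Ar : rsubmx A = array_of rows label (fun i => quadratic_column (rc i)).
  by apply/matrixP => i j; rewrite !mxE cr.
have NE : (s ^ m.+2 = s ^ m * s ^ 2)%N by rewrite -expnD addn2.
have cnt_ll i i' a b : i != i' ->
    joint_count (linear_column (lc i)) (linear_column (lc i')) a b = (s ^ m)%N.
  by move=> ii'; rewrite (linear_columns_count P_neq0 P_free) ?cardF ?(inj_eq lc_inj).
have cnt_rr i i' a b : i != i' ->
    joint_count (quadratic_column (rc i)) (quadratic_column (rc i')) a b = (s ^ m)%N.
  by move=> ii'; rewrite (quadratic_columns_count P_neq0 P_free) ?cardF ?(inj_eq rc_inj).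
have unbE (p : R) : 1 <= p -> unbalance p 2 A =
    kappa%:R * s%:R ^+ 2 * (s%:R - 1) * s%:R `^ (m%:R * p).
  (* A balanced pair must contribute 0, and the power of 0 with exponent 0 is 1. *)
  move=> p1; have p0 : p != 0 by rewrite gt_eqF // (lt_le_trans ltr01).
  rewrite (unbalance2_array_of rows_bij labelK unlabelK s_gt0 NE).
  pose G n : R := `|n%:R - (s ^ m)%N%:R| `^ p.
  have G1 : G (s ^ m)%N = 0 by rewrite /G subrr normr0 powR0.
  rewrite sum_increasing_pairs => [|i i' ii'|i i' ii']; first last.
  - rewrite big1 // => a _; rewrite big1 // => b _.
    by rewrite !cr [#|_|]cnt_rr ?subrr ?normr0 ?powR0 // neq_ltn ii'.
  - rewrite big1 // => a _; rewrite big1 // => b _.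
    by rewrite !cl [#|_|]cnt_ll ?subrr ?normr0 ?powR0 // neq_ltn ii'.
  (* The counts 0 and [s ^ m * 2] lie at the same distance [s ^ m] from the balanced count, so both
     contribute [D]. *)
  pose D : R := s%:R `^ (m%:R * p).
  have DE : D = (s ^ m)%N%:R `^ p by rewrite /D powRrM powR_mulrn ?natrX.
  have G0 : G 0%N = D by rewrite /G sub0r normrN DE normr_nat.
  have G2 : G (s ^ m * 2)%N = D by rewrite /G natrM mulr_natr mulr2n addrK DE normr_nat.
  rewrite (eq_bigr (fun=> D *+ (s ^ 2 * (s - 1)))) => [|j _].
    rewrite sumr_const card_ord -mulrnA -[LHS]mulr_natr 2!natrM natrX natrB // -/D; ring.
  rewrite -cardF in G1 G2 *.
  rewrite -(sum_mixed_columns P_neq0 P_free G1 G0 G2 (rcQ j)) -lc_sum.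
  by apply: eq_bigr => i _; rewrite cl cr cardF.
exists A; split.
- apply: (orthogonal_array1_of rows_bij labelK unlabelK s_gt0 (expnSr s m.+1)) => j a.
  case: (split_ordP j) => i ->; rewrite ?cl ?cr.
    by rewrite (linear_column_fiber P_neq0) ?cardF.
  by rewrite (quadratic_column_fiber P_neq0) ?cardF.
- by rewrite Al; apply: (orthogonal_array2_of rows_bij labelK unlabelK s_gt0 NE).
- by rewrite Ar; apply: (orthogonal_array2_of rows_bij labelK unlabelK s_gt0 NE).
- apply: tolerance_eq.
  + by rewrite exprn_gt0 // ltr0n.
  + move=> x j; rewrite col_tuples2.
    rewrite (deviation2_array_of rows_bij labelK unlabelK s_gt0 NE).
    case: (split_ordP (j ord0)) => i ->; case: (split_ordP (j ord_max)) => i' ->;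
      rewrite ?cl ?cr /= => ii'.
    * by left; rewrite [#|_|]cnt_ll ?subrr ?normr0 // neq_ltn ii'.
    * case E: (rc i') => [h b]; move: (rcQ i'); rewrite E quadratic_indicesE /= => hP.
      rewrite [#|_|](mixed_columns_count P_neq0 P_free) // cardF.
      (* [n] is the number of admissible [x]; its values 0, 1, 2 give the deviations [s ^ m], 0,
         [s ^ m]. *)
      set n := (if _ is Some _ then _ else _).
      have : (n <= 2)%N.
        rewrite /n; case: (lc i) => [[h' c']|] //; case: ifP => // _.
        exact: card_quad_roots_le2.
      case: n => [|[|[|//]]] _; [right|left|right].
      - by rewrite muln0 sub0r normrN normr_nat natrX.
      - by rewrite muln1 subrr normr0.
      - by rewrite natrM mulr_natr mulr2n addrK normr_nat natrX.
    * by move: ii'; rewrite ltnNge (leq_trans (ltnW (ltn_ord i')) (leq_addr i k1)).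
    * rewrite ltn_add2l in ii'.
      by left; rewrite [#|_|]cnt_rr ?subrr ?normr0 // neq_ltn ii'.
  (* The closed formula at [p = 1] is nonzero since [kappa > 0] and [s > 1]; hence the deviation
     [s ^ m] does occur. *)
  + rewrite unbE // !mulf_neq0 ?pnatr_eq0 -?lt0n ?expf_neq0 ?pnatr_eq0 -?lt0n //.
      by rewrite subr_eq0 pnatr_eq1 gtn_eqF.
    by rewrite gt_eqF // powR_gt0 // ltr0n.
- exact: unbE.
Qed.
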